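(* Consider the one-dimensional Maxwell--Lorentz finite difference scheme of Young (coupling the variables $B$, $E$, $P$, $J$) in the anharmonic case $\nu>0$, with parameters $\epsilon_0,\mu_0,\epsilon_\infty,\omega_1,\delta t,\delta x>0$ and $\epsilon_s\ge\epsilon_\infty$, and let $c_\infty=1/\sqrt{\epsilon_0\epsilon_\infty\mu_0}$, $\epsilon_s'=\epsilon_s/\epsilon_\infty$. The scheme is stable under the condition $$\delta t\le\min\left(\frac{\delta x}{\sqrt2\,c_\infty},\ \frac{2}{\omega_1\sqrt{2\epsilon_s'-1}}\right).$$
   Context: The scheme is, for $j,n$ integers, $$\tfrac1{\delta t}(B_{j+1/2}^{n+1/2}-B_{j+1/2}^{n-1/2})=-\tfrac1{\delta x}(E_{j+1}^n-E_j^n),\qquad \tfrac{\epsilon_0\epsilon_\infty}{\delta t}(E_j^{n+1}-E_j^n)=-\tfrac1{\mu_0\delta x}(B_{j+1/2}^{n+1/2}-B_{j-1/2}^{n+1/2})-J_j^{n+1/2},$$ $$\tfrac1{\delta t}(P_j^{n+1}-P_j^n)=J_j^{n+1/2},\qquad \tfrac1{\delta t}(J_j^{n+1/2}-J_j^{n-1/2})=-\tfrac\nu2(J_j^{n+1/2}+J_j^{n-1/2})+\omega_1^2(\epsilon_s-\epsilon_\infty)\epsilon_0E_j^n-\omega_1^2P_j^n .$$ Here $\nu$ is the damping coefficient and $\omega_1$ the resonant frequency. Put $\lambda=c_\infty\delta t/\delta x$, $\delta=\nu\delta t/2$, $\omega=\omega_1^2\delta t^2/2$, $\alpha=\epsilon_s'-1$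 and, for $\xi\in\mathbb R$, $\sigma=\lambda(e^{i\xi}-1)$, $q=|\sigma|^2=4\lambda^2\sin^2(\xi/2)$; a star denotes complex conjugation. For plane waves $U_j^n=U^n e^{i\xi j}$ in the variable $U_j^n=(c_\infty B_{j+1/2}^{n-1/2},E_j^n,P_j^n/(\epsilon_0\epsilon_\infty),\delta t\,J_j^{n-1/2}/(\epsilon_0\epsilon_\infty))^t$ the scheme reads $U^{n+1}=G(\xi)U^n$ with amplification matrix $$G(\xi)=\begin{pmatrix}1&-\sigma&0&0\\ \sigma^*&\frac{(1-q)(1+\delta)-2\omega\alpha}{1+\delta}&\frac{2\omega}{1+\delta}&-\frac{1-\delta}{1+\delta}\\ 0&\frac{2\omega\alpha}{1+\delta}&\frac{1+\delta-2\omega}{1+\delta}&\frac{1-\delta}{1+\delta}\\ 0&\frac{2\omega\alpha}{1+\delta}&\frac{-2\omega}{1+\delta}&\frac{1-\delta}{1+\delta}\end{pmatrix}.$$ Stability (in the sense of von Neumann) means: for every $\xi\in\mathbb R$, the sequence of powers $(G(\xi)^n)_{n\ge0}$ is bounded. *)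

(* Defs.v *)
From HB Require Import structures.
From mathcomp Require Import all_boot all_order all_algebra.
From mathcomp Require Import all_classical all_reals all_analysis.
From mathcomp Require Import complex.
From mathcomp Require Import ring.

Set Implicit Arguments.
Unset Strict Implicit.
Unset Printing Implicit Defensive.

Import Order.TTheory GRing.Theory Num.Theory.
Import numFieldNormedType.Exports.

Local Open Scope classical_set_scope.
Local Open Scope complex_scope.
Local Open Scope ring_scope.

Record young_params (R : realType) := YoungParams {
  eps0 : R;    (* vacuum permittivity *)
  mu0 : R;     (* vacuum permeability *)
  epsinf : R;  (* relative permittivity at infinite frequency *)
  epss : R;    (* static relative permittivity *)
  nu : R;      (* damping coefficient *)
  omega1 : R;  (* resonant frequency *)
  dt : R;      (* time step *)
  dx : R       (* space step *)
}.

Section Definitions.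
Context {R : realType} (p : young_params R).

Definition cinf : R := 1 / Num.sqrt (eps0 p * epsinf p * mu0 p).
Definition epss' : R := epss p / epsinf p.
Definition lambda : R := cinf * dt p / dx p.
Definition delta : R := nu p * dt p / 2.
Definition omega : R := omega1 p ^+ 2 * dt p ^+ 2 / 2.
Definition alpha : R := epss' - 1.

Definition expi (xi : R) : R[i] := cos xi +i* sin xi.

Definition sigma (xi : R) : R[i] := lambda%:C * (expi xi - 1).
Definition q (xi : R) : R[i] := `|sigma xi| ^+ 2.

(* Grid functions with half-integer indices are re-indexed by integers:
   B j n stands for B_{j+1/2}^{n-1/2} and J j n for J_j^{n-1/2}. *)
Definition young_scheme (B E P J : int -> int -> R[i]) : Prop :=
  forall j n : int,
  [/\ (1 / dt p)%:C * (B j (n + 1) - B j n)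
        = - (1 / dx p)%:C * (E (j + 1) n - E j n),
      (eps0 p * epsinf p / dt p)%:C * (E j (n + 1) - E j n)
        = - (1 / (mu0 p * dx p))%:C * (B j (n + 1) - B (j - 1) (n + 1))
          - J j (n + 1),
      (1 / dt p)%:C * (P j (n + 1) - P j n) = J j (n + 1) &
      (1 / dt p)%:C * (J j (n + 1) - J j n)
        = - (nu p / 2)%:C * (J j (n + 1) + J j n)
          + (omega1 p ^+ 2 * (epss p - epsinf p) * eps0 p)%:C * E j n
          - (omega1 p ^+ 2)%:C * P j n].

Definition young_G (xi : R) : 'M[R[i]]_4 :=
  let s := sigma xi in
  let d := delta%:C in let w := omega%:C in let a := alpha%:C in
  let rows : seq (seq R[i]) :=
  [:: [:: 1; - s; 0; 0];
      [:: s^*; ((1 - q xi) * (1 + d) - 2 * w * a) / (1 + d);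
          2 * w / (1 + d); - ((1 - d) / (1 + d))];
      [:: 0; 2 * w * a / (1 + d); (1 + d - 2 * w) / (1 + d);
          (1 - d) / (1 + d)];
      [:: 0; 2 * w * a / (1 + d); - 2 * w / (1 + d);
          (1 - d) / (1 + d)]] in
  \matrix_(i < 4, j < 4) (nth [::] rows i)`_j.

(* Plane waves U_j^n = U^n exp(i xi j), the components of U_j^n being
   cinf B_{j+1/2}^{n-1/2}, E_j^n, P_j^n / (eps0 epsinf) and
   dt J_j^{n-1/2} / (eps0 epsinf). *)
Definition young_plane_wave (xi : R) (U : int -> 'cV[R[i]]_4)
    (B E P J : int -> int -> R[i]) : Prop :=
  forall j n : int, let Ujn := expi (xi * j%:~R) *: U n in
  [/\ cinf%:C * B j n = Ujn (inord 0) 0,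
      E j n = Ujn (inord 1) 0,
      P j n / (eps0 p * epsinf p)%:C = Ujn (inord 2) 0 &
      (dt p)%:C * J j n / (eps0 p * epsinf p)%:C = Ujn (inord 3) 0].

Definition von_neumann_stable (G : R -> 'M[R[i]]_4) : Prop :=
  forall xi : R, [bounded G xi ^+ n | n in [set: nat]].

Definition young_stable : Prop := von_neumann_stable young_G.

End Definitions.

Lemma eq_scale (F : fieldType) (K a b x y : F) : K != 0 -> a - b = K * (x - y) -> (a = b) <-> (x = y).
Proof.
move=> K0 h; split=> e; apply/eqP; rewrite -subr_eq0.
  by move/eqP: h; rewrite e subrr eq_sym mulf_eq0 (negPf K0).
by rewrite h e subrr mulr0.
Qed.

Lemma expiD (R : realType) (x y : R) : expi (x+y) = expi x * expi y.
Proof. by rewrite /expi cosD sinD; simpc; congr (_ +i* _); ring. Qed.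
Lemma expi0 (R : realType) : expi (0 : R) = 1.
Proof. by rewrite /expi cos0 sin0. Qed.
Lemma expiN (R : realType) (x : R) : expi (-x) = (expi x)^*.
Proof. by rewrite /expi cosN sinN. Qed.
Lemma expi_neq0 (R : realType) (x : R) : expi x != 0.
Proof. by apply/eqP => h; move: (expiD x (-x)); rewrite subrr expi0 h mul0r => /eqP; rewrite oner_eq0. Qed.

(* The matrix young_G is the amplification matrix of young_scheme. *)
Lemma young_scheme_plane_wave (R : realType) (p : young_params R) (xi : R)
    (U : int -> 'cV[R[i]]_4) (B E P J : int -> int -> R[i]) :
  0 < eps0 p -> 0 < mu0 p -> 0 < epsinf p -> 0 < dt p -> 0 < dx p ->
  0 < nu p -> young_plane_wave p xi U B E P J ->
  (young_scheme p B E P J <-> forall n, U (n + 1) = young_G p xi *m U n).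
Proof.
move=> e0 m0 ei d0 x0 n0 H.
have c0 : 0 < cinf p by rewrite divr_gt0 // sqrtr_gt0 !mulr_gt0.
have cE : cinf p ^+ 2 = (eps0 p * epsinf p * mu0 p)^-1.
  by rewrite expr_div_n expr1n sqr_sqrtr ?div1r // ltW // !mulr_gt0.
have nz (a : R) : 0 < a -> a%:C != 0.
  by move=> h; rewrite -(rmorph0 (real_complex R)) (inj_eq (fmorph_inj _)) gt_eqF.
have cEC : (mu0 p)%:C = ((eps0 p)%:C * (epsinf p)%:C * (cinf p)%:C^+2)^-1.
  rewrite -!rmorphXn -!rmorphM -fmorphV; congr _%:C.
  by rewrite cE; field; rewrite !gt_eqF.
set W := fun j : int => expi (xi * j%:~R).
have WS j : W (j+1) = W j * expi xi by rewrite /W intrD mulrDr mulr1 expiD.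
have WP j : W (j-1) = W j * (expi xi)^* by rewrite /W intrD mulrDr mulrN1 expiD expiN.
have W0 j : W j != 0 by apply: expi_neq0.
have BE j n : B j n = W j * U n (inord 0) 0 / (cinf p)%:C.
  by have [h _ _ _] := H j n; apply: (mulfI (nz _ c0)); rewrite h mxE -/(W j); field; apply: nz.
have EE j n : E j n = W j * U n (inord 1) 0.
  by have [_ h _ _] := H j n; rewrite h mxE.
have PE j n : P j n = W j * U n (inord 2) 0 * (eps0 p)%:C * (epsinf p)%:C.
  have [_ _ h _] := H j n; move: h; rewrite mxE -/(W j) => <-.
  by rewrite rmorphM; field; rewrite !nz.
have JE j n : J j n = W j * U n (inord 3) 0 * (eps0 p)%:C * (epsinf p)%:C / (dt p)%:C.
  have [_ _ _ h] := H j n; move: h; rewrite mxE -/(W j) => <-.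
  by rewrite rmorphM; field; rewrite !nz.
pose u0 n := U n (inord 0) 0. pose u1 n := U n (inord 1) 0.
pose u2 n := U n (inord 2) 0. pose u3 n := U n (inord 3) 0.
set s := sigma p xi.
set d := (delta p)%:C; set w := (omega p)%:C; set a := (alpha p)%:C.
have d1 : 1 + d != 0 by rewrite -(rmorph1 (real_complex R)) -rmorphD nz // addr_gt0 // divr_gt0 // mulr_gt0.
have qE : q p xi = s * s^* by rewrite /q normCK.
have lE : (lambda p)%:C = (cinf p)%:C * (dt p)%:C / (dx p)%:C by rewrite /lambda rmorphM fmorphV rmorphM.
have two0 : (2 : R[i]) != 0 by rewrite pnatr_eq0.
have dE : d = (nu p)%:C * (dt p)%:C / 2 by rewrite /d /delta rmorphM fmorphV rmorphM rmorph_nat.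
have wE : w = (omega1 p)%:C^+2 * (dt p)%:C^+2 / 2 by rewrite /w /omega rmorphM fmorphV rmorphM !rmorphXn rmorph_nat.
have aE : a = (epss p)%:C / (epsinf p)%:C - 1 by rewrite /a /alpha /epss' rmorphB rmorphM fmorphV rmorph1.
have sE : s = (lambda p)%:C * (expi xi - 1) by [].
have scE : s^* = (lambda p)%:C * ((expi xi)^* - 1).
  by rewrite sE rmorphM rmorphB rmorph1; congr (_ * _); exact: conjc_real.
have cc0 := nz _ c0.
move: (cinf p)%:C cc0 BE cEC lE => cc cc0 BE cEC lE.
have nzz := (nz _ e0, nz _ ei, nz _ d0, nz _ x0, nz _ n0, cc0, W0, d1, nz _ m0).
have cM (x y : R) : (x * y)%:C = x%:C * y%:C by exact: rmorphM.
have cB (x y : R) : (x - y)%:C = x%:C - y%:C by exact: rmorphB.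
have cV (x : R) : (x^-1)%:C = x%:C^-1 by exact: fmorphV.
have c1 : (1:R)%:C = 1 by [].
have c2 : (2:R)%:C = 2 by exact: rmorph_nat.
have key j n :
  [/\ (1 / dt p)%:C * (B j (n + 1) - B j n)
        = - (1 / dx p)%:C * (E (j + 1) n - E j n),
      (eps0 p * epsinf p / dt p)%:C * (E j (n + 1) - E j n)
        = - (1 / (mu0 p * dx p))%:C * (B j (n + 1) - B (j - 1) (n + 1))
          - J j (n + 1),
      (1 / dt p)%:C * (P j (n + 1) - P j n) = J j (n + 1) &
      (1 / dt p)%:C * (J j (n + 1) - J j n)
        = - (nu p / 2)%:C * (J j (n + 1) + J j n)
          + (omega1 p ^+ 2 * (epss p - epsinf p) * eps0 p)%:C * E j n
          - (omega1 p ^+ 2)%:C * P j n] <->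
  [/\ u0 (n+1) = u0 n - s * u1 n,
      u1 (n+1) = u1 n + s^* * u0 (n+1) - u3 (n+1),
      u2 (n+1) = u2 n + u3 (n+1) &
      u3 (n+1) = ((1-d) * u3 n + 2 * w * a * u1 n - 2 * w * u2 n)/(1+d)].
  have A1 : (1 / dt p)%:C * (B j (n + 1) - B j n) = - (1 / dx p)%:C * (E (j + 1) n - E j n) <-> u0 (n+1) = u0 n - s * u1 n.
    apply: (@eq_scale _ (W j / (cc * (dt p)%:C))); first by rewrite mulf_neq0 ?invr_eq0 ?mulf_neq0 ?nzz.
    rewrite !BE !EE WS sE lE !cM !cV !c1 /u0 /u1.
    by field; rewrite !nzz.
  have A2 : (eps0 p * epsinf p / dt p)%:C * (E j (n + 1) - E j n)
        = - (1 / (mu0 p * dx p))%:C * (B j (n + 1) - B (j - 1) (n + 1))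
          - J j (n + 1) <-> u1 (n+1) = u1 n + s^* * u0 (n+1) - u3 (n+1).
    apply: (@eq_scale _ (W j * (eps0 p)%:C * (epsinf p)%:C / (dt p)%:C)); first by rewrite !mulf_neq0 ?invr_eq0 ?nzz.
    rewrite !BE !EE !JE WP scE lE !cM !cV !cM !c1 cEC /u0 /u1 /u3.
    by field; rewrite !nzz.
  have A3 : (1 / dt p)%:C * (P j (n + 1) - P j n) = J j (n + 1) <-> u2 (n+1) = u2 n + u3 (n+1).
    apply: (@eq_scale _ (W j * (eps0 p)%:C * (epsinf p)%:C / (dt p)%:C)); first by rewrite !mulf_neq0 ?invr_eq0 ?nzz.
    rewrite !PE !JE !cM !cV !c1 /u2 /u3.
    by field; rewrite !nzz.
  have A4 : (1 / dt p)%:C * (J j (n + 1) - J j n)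
        = - (nu p / 2)%:C * (J j (n + 1) + J j n)
          + (omega1 p ^+ 2 * (epss p - epsinf p) * eps0 p)%:C * E j n
          - (omega1 p ^+ 2)%:C * P j n <-> u3 (n+1) = ((1-d) * u3 n + 2 * w * a * u1 n - 2 * w * u2 n)/(1+d).
    apply: (@eq_scale _ ((1+d) * W j * (eps0 p)%:C * (epsinf p)%:C / (dt p)%:C^+2)); first by rewrite !mulf_neq0 ?invr_eq0 ?mulf_neq0 ?nzz.
    rewrite !PE !JE !EE; rewrite expr2 !cM !cV cB -?expr2 ?c1 c2 wE aE /u1 /u2 /u3.
    move: d1; rewrite dE => d1.
    by field; rewrite !nzz /= ?andbT; move: d1; rewrite -(inj_eq (mulfI two0)) mulr0 mulrDr mulr1 mulrCA mulfV // mulr1.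
  by split=> -[/A1 ? /A2 ? /A3 ? /A4 ?].
have key2 n : U (n+1) = young_G p xi *m U n <->
  [/\ u0 (n+1) = u0 n - s * u1 n,
      u1 (n+1) = u1 n + s^* * u0 (n+1) - u3 (n+1),
      u2 (n+1) = u2 n + u3 (n+1) &
      u3 (n+1) = ((1-d) * u3 n + 2 * w * a * u1 n - 2 * w * u2 n)/(1+d)].
  have G i : (young_G p xi *m U n) i 0 = young_G p xi i (inord 0) * u0 n + young_G p xi i (inord 1) * u1 n + young_G p xi i (inord 2) * u2 n + young_G p xi i (inord 3) * u3 n.
    rewrite mxE !big_ord_recl big_ord0 addr0 !addrA /u0 /u1 /u2 /u3; congr (_ * U _ _ _ + _ * U _ _ _ + _ * U _ _ _ + _ * U _ _ _); try (congr (young_G _ _ _ _)); by apply/val_inj; rewrite /= ?inordK.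
  split.
    move=> h; rewrite /u0 /u1 /u2 /u3 h !G !mxE !inordK //= -/s -/d -/w -/a qE.
    by rewrite -/(u0 n) -/(u1 n) -/(u2 n) -/(u3 n); split; field.
  move=> [h0 h1 h2 h3]; apply/matrixP => i k; rewrite ord1 {k} G.
  have : [\/ i = inord 0, i = inord 1, i = inord 2 | i = inord 3].
    case: i => -[|[|[|[|//]]]] hi; [constructor 1|constructor 2|constructor 3|constructor 4]; apply/val_inj; by rewrite /= inordK.
  case.
  - move->; rewrite -/(u0 _) h0 !mxE !inordK //= -/s; ring.
  - move->; rewrite -/(u1 _) h1 h0 h3 !mxE !inordK //= -/s -/d -/w -/a qE; by field.
  - move->; rewrite -/(u2 _) h2 h3 !mxE !inordK //= -/s -/d -/w -/a; by field.
  - move->; rewrite -/(u3 _) h3 !mxE !inordK //= -/s -/d -/w -/a; by field.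
split.
  by move=> S n; apply/key2/(key 0); apply: S.
by move=> S j n; apply/key/key2; apply: S.
Qed.

(* Main.v *)
Require Import Defs.
From mathcomp Require Import all_boot all_order all_algebra.
From mathcomp Require Import all_classical all_reals all_analysis.
From mathcomp Require Import complex.
From mathcomp Require Import ring lra.

Set Implicit Arguments.
Unset Strict Implicit.

Import Order.TTheory GRing.Theory Num.Theory.
Local Open Scope complex_scope.
Local Open Scope ring_scope.

(** Rotating [B] by the phase of sigma = r u (r real, |u| = 1) makes the
    coefficients of the scheme real, so real and imaginary parts decouple. With
    m = j' + j and theta = 1 - r^2/4, the quadratic form
      8w (a theta e^2 + p^2 + a (b - r e/2)^2) + (1 + d^2) m^2
        - 4w^2 (a e - p)^2
    decreases by 2d (m'^2 + m^2) at each time step (a, w, d are alpha, omega,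
    delta). Under the time step condition it is nonnegative, and for a > 0 it is
    definite unless r^2 = 2 and w (1 + 2a) = 2. In that case it degenerates
    along one direction, an eigenvector for -1; the corresponding left
    eigenvector controls this direction. For a = 0 the form controls
    only [p] and [j], which drive an undamped wave scheme for [b] and [e]
    without resonance, thanks to d > 0. *)

(** * Bounded real sequences *)

Section BoundedSequences.
Context {R : realType}.
Implicit Types (u v : nat -> R) (c : R).

Definition bounded_seq u := exists M, forall n, `|u n| <= M.

Lemma eq_bounded_seq u v : u =1 v -> bounded_seq u -> bounded_seq v.
Proof. by move=> uv [M uM]; exists M => n; rewrite -uv. Qed.

Lemma bounded_seqD u v :
  bounded_seq u -> bounded_seq v -> bounded_seq (fun n => u n + v n).
Proof.
move=> [M uM] [N vN]; exists (M + N) => n.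
by rewrite (le_trans (ler_normD _ _)) // lerD.
Qed.

Lemma bounded_seqZ c u : bounded_seq u -> bounded_seq (fun n => c * u n).
Proof.
by move=> [M uM]; exists (`|c| * M) => n; rewrite normrM ler_wpM2l.
Qed.

Lemma bounded_seq_lin c d u v w :
    (forall n, w n = c * u n + d * v n) ->
  bounded_seq u -> bounded_seq v -> bounded_seq w.
Proof.
move=> wE bu bv; apply: (@eq_bounded_seq (fun n => c * u n + d * v n)) => //.
by apply: bounded_seqD; apply: bounded_seqZ.
Qed.

Lemma bounded_seq_lin3 c d e u v w x :
    (forall n, x n = c * u n + d * v n + e * w n) ->
  bounded_seq u -> bounded_seq v -> bounded_seq w -> bounded_seq x.
Proof.
move=> xE bu bv bw.
apply: (@bounded_seq_lin 1 e (fun n => c * u n + d * v n) w) => // [n|].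
  by rewrite mul1r.
exact: bounded_seq_lin bu bv.
Qed.

Lemma bounded_seqS u : bounded_seq u -> bounded_seq (fun n => u n.+1).
Proof. by move=> [M uM]; exists M => n. Qed.

Lemma bounded_seq_sqr c M u :
  0 < c -> (forall n, c * u n ^+ 2 <= M) -> bounded_seq u.
Proof.
(* The bound comes from [|x| <= 1 + x^2], which avoids a square root. *)
move=> c0 uM; exists (1 + M / c) => n.
have u2 : u n ^+ 2 <= M / c by rewrite ler_pdivlMr // mulrC.
rewrite -[u n ^+ 2]real_normK ?num_real // in u2.
by have := sqr_ge0 (`|u n| - 1); move: u2; set x := `|u n|; nra.
Qed.

Lemma nonincreasing_le0 u : (forall n, u n.+1 <= u n) -> forall n, u n <= u 0%N.
Proof. by move=> h; elim=> // n; exact: le_trans (h n). Qed.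

Lemma bounded_seq_opp u : (forall n, u n.+1 = - u n) -> bounded_seq u.
Proof.
move=> h; exists `|u 0%N|; elim=> // n IH.
by rewrite h normrN.
Qed.

(* The invariant is u_{n+1}^2 - t u_{n+1} u_n + u_n^2, definite for |t| < 2. *)
Lemma bounded_leapfrog (t : R) u :
  t ^+ 2 < 4 -> (forall n, u n.+2 = t * u n.+1 - u n) -> bounded_seq u.
Proof.
move=> t4 hu.
pose I n := u n.+1 ^+ 2 - t * u n.+1 * u n + u n ^+ 2.
have IS n : I n.+1 <= I n.
  by rewrite le_eqVlt; apply/orP; left; apply/eqP; rewrite /I hu; ring.
apply: (@bounded_seq_sqr (1 - t ^+ 2 / 4) (I 0%N)); first lra.
move=> n; apply: le_trans (nonincreasing_le0 IS n).
have := sqr_ge0 (u n.+1 - t * u n / 2); rewrite /I; nra.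
Qed.

End BoundedSequences.

(** * Energy estimate for the scheme with real coefficients *)

Section RealRecurrence.
Context {R : realType}.
Variables (r d w a : R) (b e p j : nat -> R).
Hypotheses (r2 : r ^+ 2 <= 2) (d0 : 0 < d) (w0 : 0 < w) (a0 : 0 <= a).
Hypothesis wa : w * (1 + 2 * a) <= 2.
Hypothesis bS : forall n, b n.+1 = b n - r * e n.
Hypothesis eS : forall n, e n.+1 = e n + r * b n.+1 - j n.+1.
Hypothesis pS : forall n, p n.+1 = p n + j n.+1.
Hypothesis jS :
  forall n, (1 + d) * j n.+1 = (1 - d) * j n + 2 * w * (a * e n - p n).

Let d1 : 1 + d != 0. Proof. by rewrite gt_eqF // addr_gt0. Qed.

Let th : R := 1 - r ^+ 2 / 4.
Let th2 : 1 <= 2 * th. Proof. by have := r2; rewrite /th; lra. Qed.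
Let th0 : 0 < th. Proof. by have := th2; lra. Qed.
(** Equals [2 * th - w * (a + th)]. In this split form both terms are nonnegative, by [wa] and
    [th2], so [K = 0] forces each of them to vanish. *)
Let K : R := th * (2 - w * (1 + 2 * a)) + w * a * (2 * th - 1).
Let K0 : 0 <= K.
Proof.
by rewrite /K addr_ge0 // !mulr_ge0 ?(ltW th0) ?(ltW w0) // subr_ge0.
Qed.

Definition energy n : R :=
  8 * w * (a * th * e n ^+ 2 + p n ^+ 2) - 4 * w ^+ 2 * (a * e n - p n) ^+ 2
  + 8 * w * a * (b n - r * e n / 2) ^+ 2 + (1 + d ^+ 2) * (j n.+1 + j n) ^+ 2.

Lemma energyS n : energy n.+1 = energy n
  - 2 * d * ((j n.+2 + j n.+1) ^+ 2 + (j n.+1 + j n) ^+ 2).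
Proof.
have w0' : w != 0 by rewrite gt_eqF.
(* Solving [jS] for [p n] and for [j n.+2] leaves a rational identity in [b n], [e n], [j n] and
   [j n.+1]. *)
have pE : p n = a * e n - ((1 + d) * j n.+1 - (1 - d) * j n) / (2 * w).
  by rewrite jS; field.
have jE : j n.+2 =
    ((1 - d) * j n.+1 + 2 * w * (a * e n.+1 - p n.+1)) / (1 + d).
  by rewrite -jS mulrC mulKf.
by rewrite /energy /th jE eS pS bS pE; field; rewrite w0' d1.
Qed.

Lemma energy_le n : energy n <= energy 0.
Proof.
apply: nonincreasing_le0 => {}n; rewrite energyS lerBlDr lerDl.
by rewrite mulr_ge0 ?addr_ge0 ?sqr_ge0 // mulr_ge0 ?ltW.
Qed.

(** The negative term is absorbed through [th (a e - p)^2 + a (th e + p)^2 = (a + th) (a th e^2 +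
    p^2)], which leaves squares with nonnegative coefficients. *)
Lemma energyE n : th * energy n =
  4 * w * K * (a * th * e n ^+ 2 + p n ^+ 2)
  + 4 * w ^+ 2 * a * (th * e n + p n) ^+ 2
  + 8 * th * w * a * (b n - r * e n / 2) ^+ 2
  + th * (1 + d ^+ 2) * (j n.+1 + j n) ^+ 2.
Proof. by rewrite /energy /K /th; field. Qed.

Let m n := j n.+1 + j n.
(** The factor [a] in [z] and [y] keeps their bounds valid for [a = 0], where the energy does not
    see [e] and [b]. *)
Let z n := a * (th * e n + p n).
Let y n := a * (b n - r * e n / 2).

Let th_energy_ge n :
  [/\ 4 * w * K * p n ^+ 2 <= th * energy 0,
      4 * w ^+ 2 * z n ^+ 2 <= a * (th * energy 0),
      8 * th * w * y n ^+ 2 <= a * (th * energy 0) &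
      th * (1 + d ^+ 2) * m n ^+ 2 <= th * energy 0].
Proof.
have tE : th * energy n <= th * energy 0 by rewrite ler_pM2l // energy_le.
have t1 : 0 <= 4 * w * K * (a * th * e n ^+ 2).
  by rewrite !(sqr_ge0, ltW w0, ltW th0, mulr_ge0).
have t2 : 0 <= 4 * w * K * p n ^+ 2.
  by rewrite !(sqr_ge0, ltW w0, ltW th0, mulr_ge0).
have t3 : 0 <= 4 * w ^+ 2 * a * (th * e n + p n) ^+ 2.
  by rewrite !(sqr_ge0, mulr_ge0).
have t4 : 0 <= 8 * th * w * a * (b n - r * e n / 2) ^+ 2.
  by rewrite !(sqr_ge0, ltW w0, ltW th0, mulr_ge0).
have t5 : 0 <= th * (1 + d ^+ 2) * (j n.+1 + j n) ^+ 2.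
  by rewrite !(sqr_ge0, ltW w0, ltW th0, mulr_ge0, addr_ge0).
rewrite energyE in tE.
have zE : 4 * w ^+ 2 * z n ^+ 2 = a * (4 * w ^+ 2 * a * (th * e n + p n) ^+ 2).
  by rewrite /z; ring.
have yE : 8 * th * w * y n ^+ 2
    = a * (8 * th * w * a * (b n - r * e n / 2) ^+ 2).
  by rewrite /y; ring.
rewrite mulrDr in tE; rewrite zE yE; split; try (apply: ler_wpM2l => //).
all: by rewrite ?/m; lra.
Qed.

Let bounded_m : bounded_seq m.
Proof.
apply: (@bounded_seq_sqr _ (th * (1 + d ^+ 2)) (th * energy 0)).
  by rewrite mulr_gt0 // ltr_pwDl ?sqr_ge0.
by move=> n; have [] := th_energy_ge n.
Qed.

Let bounded_z : bounded_seq z.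
Proof.
apply: (@bounded_seq_sqr _ (4 * w ^+ 2) (a * (th * energy 0))).
  by rewrite mulr_gt0 // exprn_gt0.
by move=> n; have [] := th_energy_ge n.
Qed.

Let bounded_y : bounded_seq y.
Proof.
apply: (@bounded_seq_sqr _ (8 * th * w) (a * (th * energy 0))).
  by rewrite !mulr_gt0.
by move=> n; have [] := th_energy_ge n.
Qed.

Let mE n : (1 + d) * m n = 2 * (j n + w * (a * e n - p n)).
Proof. by rewrite /m mulrDr jS; ring. Qed.

Lemma bounded_p : bounded_seq p.
Proof.
have [Kgt0|] := boolP (0 < K).
  apply: (@bounded_seq_sqr _ (4 * w * K) (th * energy 0)).
    by rewrite !mulr_gt0.
  by move=> n; have [] := th_energy_ge n.
rewrite -leNgt => Kle0.
have /eqP : K = 0 by apply/eqP; rewrite eq_le Kle0.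
rewrite paddr_eq0 ?(mulr_ge0, ltW th0, ltW w0, a0) ?subr_ge0 //.
rewrite !mulf_eq0 (gt_eqF th0) (gt_eqF w0) /= => /andP[/eqP wa2 /eqP ath].
have {}wa2 : w * (1 + 2 * a) = 2 by lra.
have {}ath : a * (2 * th - 1) = 0.
  by apply/eqP; rewrite mulf_eq0; apply/orP; move: ath => /eqP/orP.
(* [l] is the left eigenvector of the amplification matrix for the
   eigenvalue -1, which occurs exactly when [K = 0]. *)
pose l n := w * a * (r * b n - 2 * e n) + w * p n - (1 - d) * j n.
have lS n : l n.+1 = - l n.
  apply/eqP; rewrite -subr_eq0 opprK.
  have -> : l n.+1 + l n = (w * (1 + 2 * a) - 2) * j n.+1
      + ((1 + d) * j n.+1 - ((1 - d) * j n + 2 * w * (a * e n - p n)))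
      - 2 * w * e n * (a * (2 * th - 1)).
    by rewrite /l eS pS bS /th; field.
  by rewrite wa2 ath jS !subrr mul0r mulr0 subr0 addr0.
have bounded_l : bounded_seq l by apply: bounded_seq_opp.
(* In the degenerate case [k n] equals [2 * d * p n] minus a multiple of [m n], so that [d > 0]
   allows solving for [p n]. *)
pose k n := 1 * l n + - (w * r) * y n + 2 * w * d * z n.
have bounded_k : bounded_seq k by apply: bounded_seq_lin3 bounded_l bounded_y _.
apply: (@bounded_seq_lin _ (2 * d)^-1 ((1 - d) * (1 + d) / (4 * d)) k m) =>
  // n.
have aeE : a * e n = 2 * z n - 2 * a * p n.
  have := congr1 ( *%R (e n)) ath; rewrite mulr0 /z => h.
  by apply/eqP; rewrite -subr_eq0 -oppr_eq0 -h; apply/eqP; ring.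
have wap : w * p n = 2 * p n - 2 * w * a * p n.
  by transitivity (w * (1 + 2 * a) * p n - 2 * w * a * p n);
    [ring | rewrite wa2].
have jE : j n = (1 + d) / 2 * m n - 2 * w * z n + 2 * p n.
  have := mE n; rewrite aeE => h.
  have -> : j n = (1 + d) * m n / 2 - w * (2 * z n - 2 * a * p n) + w * p n.
    by rewrite h; field.
  by rewrite wap; ring.
have lE : l n = w * r * y n - w * (a * e n) + w * p n - (1 - d) * j n.
  apply/eqP; rewrite -subr_eq0; apply/eqP.
  transitivity (- w * e n * (a * (2 * th - 1))); last by rewrite ath mulr0.
  by rewrite /l /y /th; field.
rewrite /k lE aeE jE wap; field.
by rewrite gt_eqF.
Qed.

Let bounded_ae : bounded_seq (fun n => a * e n).
Proof.
apply: (@bounded_seq_lin _ th^-1 (- (a / th)) z p) => // [n|].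
  by rewrite /z; field; rewrite gt_eqF.
exact: bounded_p.
Qed.

Lemma bounded_j : bounded_seq j.
Proof.
apply: (@bounded_seq_lin3 _ ((1 + d) / 2) (- w) w m (fun n => a * e n) p) => //.
  by move=> n; have := mE n; lra.
exact: bounded_p.
Qed.

(* For [a = 0] the fields [b] and [e] satisfy the undamped wave scheme forced by
   [j]. The characteristic polynomials of [j] and of the wave part are coprime
   for 0 < r^2 < 4: the roots of the latter are conjugate and of modulus 1, those
   of the former have a product of modulus < 1. Applying the former to [b]
   leaves a homogeneous wave recurrence, and a Bezout combination recovers
   [b]. *)
Lemma bounded_be_uncoupled : a = 0 -> bounded_seq b /\ bounded_seq e.
Proof.
move=> a00; have [r0|r0] := eqVneq r 0.
  have bb : bounded_seq b.
    by exists `|b 0%N|; elim=> // n IH; rewrite bS r0 mul0r subr0.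
  split=> //.
  (* Without the wave coupling, [e + p] is conserved. *)
  have : bounded_seq (fun n => e n + p n).
    exists `|e 0%N + p 0%N|; elim=> // n IH.
    by have -> : e n.+1 + p n.+1 = e n + p n; [rewrite eS pS r0; ring | ].
  move=> /(@bounded_seq_lin _ 1 (-1) _ p e); apply; last exact: bounded_p.
  by move=> n; ring.
pose t := 2 - r ^+ 2.
have bSS n : b n.+2 = t * b n.+1 - b n + r * j n.+1.
  by rewrite /t bS eS bS; ring.
have jSS n : (1 + d) * j n.+2 = (2 - 2 * w) * j n.+1 - (1 - d) * j n.
  transitivity ((1 - d) * j n.+1 - 2 * w * (p n + j n.+1)).
    by rewrite jS pS a00; ring.
  by have := jS n; rewrite a00 mul0r sub0r mulrN mulrDl mul1r => h; lra.
pose c n := (1 + d) * b n.+2 - (2 - 2 * w) * b n.+1 + (1 - d) * b n.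
have r2gt0 : 0 < r ^+ 2 by rewrite exprn_even_gt0.
have t4 : t ^+ 2 < 4 by rewrite /t; move: r2 r2gt0; nra.
have cb : bounded_seq c.
  apply: (bounded_leapfrog t4) => n; rewrite /c.
  rewrite (bSS n.+2) (bSS n.+1) (bSS n).
  apply/eqP; rewrite -subr_eq0; apply/eqP.
  transitivity
    (r * ((1 + d) * j n.+3 - ((2 - 2 * w) * j n.+2 - (1 - d) * j n.+1))).
    by ring.
  by rewrite jSS subrr mulr0.
(* Up to sign, [B X + 2 d] is the remainder of the characteristic polynomial of [j] modulo
   [X^2 - t X + 1], that of the wave part. *)
pose B := 2 - 2 * w - t * (1 + d).
pose g n := B * b n.+1 + 2 * d * b n.
have bg : bounded_seq g.
  apply: (@bounded_seq_lin _ (-1) ((1 + d) * r) c (fun n => j n.+1)) => //.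
    by move=> n; rewrite /g /c bSS /B; ring.
  exact/bounded_seqS/bounded_j.
(* This is the resultant of [X^2 - t X + 1] and [B X + 2 d]. Dividing by it solves for [b n] after
   eliminating [b n.+1] between [g n] and [g n.+1]. *)
have D0 : 0 < B ^+ 2 + 2 * d * B * t + 4 * d ^+ 2.
  have -> : B ^+ 2 + 2 * d * B * t + 4 * d ^+ 2
    = (B + d * t) ^+ 2 + d ^+ 2 * (4 - t ^+ 2) by ring.
  by rewrite ltr_wpDl ?sqr_ge0 // mulr_gt0 ?exprn_gt0 ?subr_gt0.
set D := (X in 0 < X) in D0.
have bb : bounded_seq b.
  apply: (@bounded_seq_lin3 _ ((B * t + 2 * d) / D) (- (B / D)) (B ^+ 2 * r / D)
    g (fun n => g n.+1) (fun n => j n.+1)) => //.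
  - move=> n; rewrite /g bSS /D; field.
    by rewrite gt_eqF.
  - exact: bounded_seqS.
  - exact/bounded_seqS/bounded_j.
split=> //.
apply: (@bounded_seq_lin _ r^-1 (- r^-1) b (fun n => b n.+1)) => //.
  by move=> n; rewrite bS; field.
exact: bounded_seqS.
Qed.

Lemma bounded_recurrence :
  [/\ bounded_seq b, bounded_seq e, bounded_seq p & bounded_seq j].
Proof.
have bp := bounded_p; have bj := bounded_j.
have [/bounded_be_uncoupled[]//|a_neq0] := eqVneq a 0.
have be : bounded_seq e.
  apply: (@bounded_seq_lin _ a^-1 0 _ p _ _ bounded_ae) => // n.
  by field.
split=> //.
apply: (@bounded_seq_lin _ a^-1 (r / 2) y e) => // n.
by rewrite /y; field.
Qed.

End RealRecurrence.

(** * Reduction of the complex scheme to real and imaginary parts *)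

Section ComplexRecurrence.
Context {R : realType}.
Implicit Types (u v : nat -> R[i]).

Definition bounded_cseq u :=
  bounded_seq (@complex.Re R \o u) /\ bounded_seq (@complex.Im R \o u).

Lemma normc_le (x : R[i]) : `|x| <= (`|complex.Re x| + `|complex.Im x|)%:C.
Proof.
rewrite [in leLHS](complexE x) (le_trans (ler_normD _ _)) // rmorphD lerD //.
- by rewrite normc_def /= expr0n addr0 sqrtr_sqr.
- rewrite normrM !normc_def /= !expr0n /= !addr0 !add0r expr1n sqrtr1.
  by rewrite sqrtr_sqr mul1r.
Qed.

Lemma bounded_cseq_norm u :
  bounded_cseq u -> exists M : R, forall n, `|u n| <= M%:C.
Proof.
move=> [[M uM] [N uN]]; exists (M + N) => n.
by rewrite (le_trans (normc_le _)) // lecR; exact: lerD (uM n) (uN n).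
Qed.

Lemma ReMr (r : R) (x : R[i]) : complex.Re (r%:C * x) = r * complex.Re x.
Proof. by case: x => x y /=; rewrite mul0r subr0. Qed.

Lemma ImMr (r : R) (x : R[i]) : complex.Im (r%:C * x) = r * complex.Im x.
Proof. by case: x => x y /=; rewrite mul0r addr0. Qed.

Lemma bounded_cseqM c u : bounded_cseq u -> bounded_cseq (fun n => c * u n).
Proof.
case: c => x y [bRe bIm]; split.
  apply: (@bounded_seq_lin _ x (- y) _ _ _ _ bRe bIm) => n /=.
  by case: (u n) => v w /=; rewrite mulNr.
apply: (@bounded_seq_lin _ x y _ _ _ _ bIm bRe) => n /=.
by case: (u n).
Qed.

Lemma bounded_crecurrence (r d w a : R) (s u : R[i]) (b e p j : nat -> R[i]) :
    r ^+ 2 <= 2 -> 0 < d -> 0 < w -> 0 <= a -> w * (1 + 2 * a) <= 2 ->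
    u * u^*%C = 1 -> s = r%:C * u ->
    (forall n, b n.+1 = b n - s * e n) ->
    (forall n, e n.+1 = e n + s^*%C * b n.+1 - j n.+1) ->
    (forall n, p n.+1 = p n + j n.+1) ->
    (forall n, (1 + d%:C) * j n.+1 =
       (1 - d%:C) * j n + 2 * w%:C * (a%:C * e n - p n)) ->
  [/\ bounded_cseq b, bounded_cseq e, bounded_cseq p & bounded_cseq j].
Proof.
move=> r2 d0 w0 a0 wa uu sE bS eS pS jS.
pose f n := u^*%C * b n.
have fS n : f n.+1 = f n - r%:C * e n.
  rewrite /f bS sE mulrBr; congr (_ - _).
  by rewrite mulrCA !mulrA -(mulrA r%:C) uu mulr1.
have {}eS n : e n.+1 = e n + r%:C * f n.+1 - j n.+1.
  have sJ : s^*%C = r%:C * u^*%C.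
    by rewrite sE rmorphM; congr (_ * _); exact: conjc_real.
  by rewrite eS sJ mulrA.
have {}jS n : (1 + d)%:C * j n.+1 =
    (1 - d)%:C * j n + (2 * w)%:C * (a%:C * e n - p n).
  by rewrite rmorphD rmorphB rmorphM rmorph1 rmorph_nat jS.
(* After the rotation every coefficient is real, so any real-linear [F] maps the complex orbit to a
   real one. *)
have part (F : R[i] -> R) :
    {morph F : x y / x + y} -> {morph F : x y / x - y} ->
    (forall c x, F (c%:C * x) = c * F x) ->
    [/\ bounded_seq (F \o f), bounded_seq (F \o e),
        bounded_seq (F \o p) & bounded_seq (F \o j)].
  move=> FD FB FZ; apply: (bounded_recurrence r2 d0 w0 a0 wa) => n /=.
  - by rewrite fS FB FZ.
  - by rewrite eS FB FD FZ.
  - by rewrite pS FD.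
  - by rewrite -FZ jS FD !FZ FB FZ.
have [f1 e1 p1 j1] :=
  part _ (raddfD (@complex.Re R)) (raddfB (@complex.Re R)) ReMr.
have [f2 e2 p2 j2] :=
  part _ (raddfD (@complex.Im R)) (raddfB (@complex.Im R)) ImMr.
split=> //.
have -> : b = (fun n => u * f n).
  by apply/funext => n; rewrite /f mulrA uu mul1r.
exact: bounded_cseqM.
Qed.

End ComplexRecurrence.

(** * Powers of the amplification matrix *)

Section AmplificationMatrix.
Context {R : realType} (p : young_params R).

(** Half-angle formula, with [u = i * expi (xi / 2)]. The real factor is signed, so nothing is
    divided by the modulus of sigma, which may vanish. *)
Lemma sigma_polar (xi : R) : exists2 u : R[i], u * u^*%C = 1 &
  sigma p xi = (2 * lambda p * sin (xi / 2))%:C * u.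
Proof.
exists (- sin (xi / 2) +i* cos (xi / 2)).
  have /eqP := cos2Dsin2 (xi / 2); rewrite -subr_eq0 => /eqP h.
  apply/eqP; rewrite eq_complex /=; apply/andP.
  by split; apply/eqP; move: h; lra.
rewrite /sigma /expi.
have xiE : xi = (xi / 2) *+ 2 by rewrite mulr2n; field.
rewrite {1 2}xiE cos_mulr2n sin_mulr2n cos2sin2.
by apply/eqP; rewrite eq_complex /=; apply/andP; split; apply/eqP; ring.
Qed.

(** Column [k] of the powers is the orbit of the [k]-th basis vector, hence a solution of the
    recurrence. *)
Lemma young_G_powers_bounded (xi r : R) (u : R[i]) :
    r ^+ 2 <= 2 -> 0 < delta p -> 0 < omega p -> 0 <= alpha p ->
    omega p * (1 + 2 * alpha p) <= 2 ->
    u * u^*%C = 1 -> sigma p xi = r%:C * u ->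
  forall k, exists M : R, forall i n, `|(young_G p xi ^+ n) i k| <= M%:C.
Proof.
move=> r2 d0 w0 a0 wa uu sE k.
set s := sigma p xi in sE *.
set d := (delta p)%:C; set w := (omega p)%:C; set a := (alpha p)%:C.
have d1 : 1 + d != 0.
  rewrite /d -(rmorph1 (real_complex R)) -rmorphD /= eq_complex /=.
  by rewrite gt_eqF // addr_gt0.
have qE : q p xi = s * s^*%C by rewrite /q normCK.
pose U i n := (young_G p xi ^+ n) (inord i) k.
have G i n : (young_G p xi ^+ n.+1) i k =
    young_G p xi i (inord 0) * U 0%N n + young_G p xi i (inord 1) * U 1%N n
    + young_G p xi i (inord 2) * U 2%N n + young_G p xi i (inord 3) * U 3%N n.
  rewrite exprS mxE !big_ord_recl big_ord0 addr0 !addrA /U.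
  by congr (_ * _ + _ * _ + _ * _ + _ * _);
    congr (fun_of_matrix _ _ _); apply/val_inj; rewrite /= ?inordK.
(* One opaque name for the two convertible forms of the conjugate gives [field] a single atom. *)
have [sJ sJE] : exists x, s^*%C = x by exists s^*%C.
have US n : [/\ U 0%N n.+1 = U 0%N n - s * U 1%N n,
    U 1%N n.+1 = U 1%N n + sJ * U 0%N n.+1 - U 3%N n.+1,
    U 2%N n.+1 = U 2%N n + U 3%N n.+1 &
    (1 + d) * U 3%N n.+1 =
      (1 - d) * U 3%N n + 2 * w * (a * U 1%N n - U 2%N n)].
  rewrite [U 0%N n.+1]G [U 1%N n.+1]G [U 2%N n.+1]G [U 3%N n.+1]G.
  rewrite !mxE !inordK //= -/s -/d -/w -/a qE sJE (sJE : (s^*)%R = sJ).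
  by split; field.
have [/bounded_cseq_norm[M0 h0] /bounded_cseq_norm[M1 h1]
    /bounded_cseq_norm[M2 h2] /bounded_cseq_norm[M3 h3]] :
    [/\ bounded_cseq (U 0%N), bounded_cseq (U 1%N),
        bounded_cseq (U 2%N) & bounded_cseq (U 3%N)].
  by apply: (bounded_crecurrence r2 d0 w0 a0 wa uu sE) => n;
    rewrite ?sJE; have [] := US n.
have ge0 (M : R) (f : nat -> R[i]) : (forall n, `|f n| <= M%:C) -> 0 <= M.
  by move=> /(_ 0%N) h; rewrite -ler0c (le_trans _ h).
have [[[M00 M10] M20] M30] := (ge0 _ _ h0, ge0 _ _ h1, ge0 _ _ h2, ge0 _ _ h3).
exists (M0 + M1 + M2 + M3) => i n.
have [->|->|->|->] : [\/ i = inord 0, i = inord 1, i = inord 2 | i = inord 3].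
  by case: i => -[|[|[|[|//]]]] hi;
    [constructor 1|constructor 2|constructor 3|constructor 4];
    apply/val_inj; rewrite /= inordK.
- by apply: le_trans (h0 n) _; rewrite lecR; lra.
- by apply: le_trans (h1 n) _; rewrite lecR; lra.
- by apply: le_trans (h2 n) _; rewrite lecR; lra.
- by apply: le_trans (h3 n) _; rewrite lecR; lra.
Qed.

End AmplificationMatrix.

(** The matrix norm is zero or attained at an entry, so the sum of the column bounds dominates
    it. *)
Lemma bounded_mx_entries (R : realType) (m n : nat)
    (A : nat -> 'M[R[i]]_(m, n)) :
    (forall k, exists M : R, forall i l, `|A l i k| <= M%:C) ->
  [bounded A l | l in [set: nat]]%classic.
Proof.
move=> /choice[M hM]; pose N := \sum_k `|M k|.
have N0 : 0 <= N by rewrite sumr_ge0.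
have AN l : `|A l| <= N%:C.
  rewrite -[`|A l|]/(mx_norm (A l)).
  have [->|/mx_norm_neq0[[i k] /= ->]] := eqVneq (mx_norm (A l)) 0.
    by rewrite ler0c.
  rewrite (le_trans (hM k i l)) // lecR (le_trans (ler_norm _)) //.
  by rewrite /N (bigD1 k) //= lerDl sumr_ge0.
rewrite /bounded_near; near=> K => l _ /=; apply: le_trans (AN l) _.
by near: K; apply: nbhs_pinfty_ge; rewrite ger0_real // ler0c.
Unshelve. all: by end_near. Qed.

(** * From the time step condition to the reduced parameters *)

Theorem mainTheorem5 (R : realType) (p : young_params R)
    (eps0_gt0 : 0 < eps0 p) (mu0_gt0 : 0 < mu0 p) (epsinf_gt0 : 0 < epsinf p)
    (omega1_gt0 : 0 < omega1 p) (dt_gt0 : 0 < dt p) (dx_gt0 : 0 < dx p)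
    (nu_gt0 : 0 < nu p) (epss_ge : epsinf p <= epss p)
    (cfl : dt p <= Num.min (dx p / (Num.sqrt 2 * cinf p))
                           (2 / (omega1 p * Num.sqrt (2 * epss' p - 1)))) :
  young_stable p.
Proof.
move=> xi; apply: bounded_mx_entries.
have [u uu sE] := sigma_polar p xi.
move: cfl; rewrite le_min => /andP[cfl1 cfl2].
have c0 : 0 < cinf p by rewrite divr_gt0 // sqrtr_gt0 !mulr_gt0.
have es : 1 <= epss' p by rewrite /epss' ler_pdivlMr // mul1r.
have a0 : 0 <= alpha p by rewrite subr_ge0.
(* The first bound on [dt p] yields [r^2 <= 2] for [r = 2 * lambda p * sin (xi / 2)]. *)
have l2 : lambda p ^+ 2 * 2 <= 1.
  have l0 : 0 <= lambda p by rewrite /lambda ltW // divr_gt0 // mulr_gt0.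
  have : lambda p * Num.sqrt 2 <= 1.
    have s0 : 0 < Num.sqrt 2 * cinf p by rewrite mulr_gt0 // sqrtr_gt0.
    rewrite ler_pdivlMr // in cfl1.
    rewrite /lambda mulrAC ler_pdivrMr // mul1r (le_trans _ cfl1) //.
    by rewrite le_eqVlt; apply/orP; left; apply/eqP; ring.
  move=> h; rewrite -[2](@sqr_sqrtr R) // -exprMn expr_le1 //.
  by rewrite mulr_ge0 ?sqrtr_ge0.
(* Here [1 + 2 * alpha p = 2 * epss' p - 1], so this is the square of the second bound on [dt p]. *)
have wa : omega p * (1 + 2 * alpha p) <= 2.
  have e0 : 0 < 2 * epss' p - 1 by lra.
  have : omega1 p * dt p * Num.sqrt (2 * epss' p - 1) <= 2.
    rewrite ler_pdivlMr ?mulr_gt0 ?sqrtr_gt0 // in cfl2.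
    by rewrite (mulrC (omega1 p)) -mulrA.
  have -> : omega p * (1 + 2 * alpha p)
      = (omega1 p * dt p * Num.sqrt (2 * epss' p - 1)) ^+ 2 / 2.
    by rewrite !exprMn sqr_sqrtr ?(ltW e0) // /omega /alpha; field.
  set x := _ * Num.sqrt _ => hx.
  have x0 : 0 <= x.
    by rewrite /x !mulr_ge0 ?sqrtr_ge0 ?(ltW omega1_gt0) ?(ltW dt_gt0).
  by nra.
apply: (@young_G_powers_bounded _ _ _ _ u _ _ _ a0 wa uu sE).
- have : sin (xi / 2) ^+ 2 <= 1 by rewrite sin2cos2 lerBlDr lerDl sqr_ge0.
  have -> : (2 * lambda p * sin (xi / 2)) ^+ 2
      = 2 * ((lambda p ^+ 2 * 2) * sin (xi / 2) ^+ 2) by ring.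
  have l0 : 0 <= lambda p ^+ 2 * 2 by rewrite mulr_ge0 // sqr_ge0.
  have s0 := sqr_ge0 (sin (xi / 2)).
  by move=> s1; rewrite ger_pMr // mulr_ile1.
- by rewrite /delta divr_gt0 // mulr_gt0.
- by rewrite /omega divr_gt0 // mulr_gt0 // exprn_gt0.
Qed.
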